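(* Let $f\colon X\to Y$ be a function between admissibly represented countably based $T_0$-spaces. Then $f$ is $j_\Delta$-realizable if and only if $f$ is $\mathbf{\Delta}^0_2$-piecewise continuous.
   Context: $\omega^\omega$ is Baire space; $\subseteq$ in $F\colon\subseteq A\to B$ indicates a partial function. Equations between compositions of partial functions are equalities of partial functions (same domain, same values). A partial function on $\omega^\omega$ is continuous if it is continuous on its domain with the subspace topology. A representation of a set $X$ is a surjective partial function $\rho\colon\subseteq\omega^\omega\to X$. A representation $\rho$ of a topological space $X$ is admissible if $\rho$ is continuous and for every continuous $g\colon\subseteq\omega^\omega\to X$ there is a continuous $G\colon\subseteq\omega^\omega\to\omega^\omega$ with $g=\rho\circ G$. $X$ and $Y$ carry admissible representations $\rho_X,\rho_Y$. $\langle\cdots\rangle_{n\in\omega}\colon(\omega^\omega)^\omega\to\omega^\omega$ is a fixed (computable) encoding of countable sequences of elements of $\omega^\omega$ as elements of $\omega^\omega$, for example the homeomorphism with $\langle\xi_n\rangle_{n\in\omega}(\langle n,m\rangle)=\xi_n(m)$ for a computable bijection $\langle\cdot,\cdot\rangle\colon\omega^2\to\omega$. The jump operator $j_\Delta\colon\subseteq\omega^\omega\to\omega^\omega$ has domain the set of $\langle\xi_n\rangle_{n\in\omega}$ such that $(\exists n)(\forall m\geq n)[\xi_m=\xi_n]$, and $j_\Delta(\langle\xi_n\rangle_{n\in\omega})=\lim_{n}\xi_n$. $f\colon X\to Y$ is $j_\Delta$-realizable if there is a partial continuous $F\colon\subseteq\omega^\omega\to\omega^\omega$ with $f\circ\rho_X=\rho_Y\circ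 j_\Delta\circ F$. For a topological space $X$, $\mathbf{\Sigma}^0_1(X)$ is the set of open sets; $\mathbf{\Sigma}^0_2(X)$ is the set of all $A\subseteq X$ of the form $A=\bigcup_{i\in\omega}B_i\setminus B_i'$ with all $B_i,B_i'$ open; $\mathbf{\Pi}^0_2(X)$ consists of the complements of $\mathbf{\Sigma}^0_2$-sets; $\mathbf{\Delta}^0_2(X)=\mathbf{\Sigma}^0_2(X)\cap\mathbf{\Pi}^0_2(X)$. A total function $f\colon X\to Y$ is $\mathbf{\Delta}^0_2$-piecewise continuous iff there is a family $\{A_i\}_{i\in\omega}$ of sets in $\mathbf{\Delta}^0_2(X)$ such that $X=\bigcup_{i\in\omega}A_i$ and $f|_{A_i}\colon A_i\to Y$ is continuous for all $i\in\omega$. *)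

(* Defs.v *)
From HB Require Import structures.
From mathcomp Require Import all_boot.
From mathcomp Require Import all_classical.
From mathcomp Require Import topology.
From Stdlib Require Cantor.

Set Implicit Arguments.
Unset Strict Implicit.
Unset Printing Implicit Defensive.

Local Open Scope classical_set_scope.

Definition baire : Type := prod_topology (fun _ : nat => nat).

HB.instance Definition _ := Pointed.on baire.
HB.instance Definition _ := Topological.on baire.

(* A partial function from T to U is a function T -> option U, undefined
   where it takes the value None.  The composite of partial functions is
   ssrfun's pcomp, and equality of partial functions is =1. *)
Definition pdom (T U : Type) (F : T -> option U) : set T := [set x | F x].

(* Preimages of open sets are relatively open in the domain. *)
Definition pcontinuous (T U : topologicalType) (F : T -> option U) : Prop :=
  forall V : set U, open V ->
    open (F @^-1` (Some @` V) : set (subspace (pdom F))).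

Definition representation (X : Type) (rho : baire -> option X) : Prop :=
  forall x, exists p, rho p = Some x.

Definition admissible (X : topologicalType) (rho : baire -> option X) : Prop :=
  [/\ representation rho,
      pcontinuous rho &
      forall g : baire -> option X, pcontinuous g ->
        exists2 G : baire -> option baire, pcontinuous G & g =1 pcomp rho G].

(* An encoding of sequences of points of Baire space by points of Baire space
   is any homeomorphism, where the set of sequences carries the product
   topology.  Realizability below is by continuous functions, so computability
   of the encoding plays no role.  pair_encoding is the usual example,
   obtained from the Cantor pairing function. *)
Record seq_encoding := SeqEncoding {
  enc : {ptws nat -> baire} -> baire;
  dec : baire -> {ptws nat -> baire};
  encK : cancel enc dec;
  decK : cancel dec enc;
  enc_continuous : continuous enc;
  dec_continuous : continuous dec }.

Definition pair_enc (xi : {ptws nat -> baire}) : baire :=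
  fun k => xi (Cantor.of_nat k).1 (Cantor.of_nat k).2.

Definition pair_dec (p : baire) : {ptws nat -> baire} :=
  fun n m => p (Cantor.to_nat (n, m)).

Lemma pair_encK : cancel pair_enc pair_dec.
Proof.
by move=> xi; apply/funext => n; apply/funext => m;
  rewrite /pair_dec /pair_enc Cantor.cancel_of_to.
Qed.

Lemma pair_decK : cancel pair_dec pair_enc.
Proof.
move=> p; apply/funext => k; rewrite /pair_dec /pair_enc.
by rewrite -surjective_pairing Cantor.cancel_to_of.
Qed.

Lemma prod_continuous (S : topologicalType) (I : Type)
    (T : I -> topologicalType) (f : S -> prod_topology T) :
  (forall i, continuous (fun x => f x i)) -> continuous f.
Proof.
move=> cf x; apply/cvg_sup => i U [_ /= [[W oW <-] Wfx WU]].
apply: filterS WU _; apply: (cf i x).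
by apply: open_nbhs_nbhs; split.
Qed.

Lemma pair_enc_continuous : continuous pair_enc.
Proof.
apply: prod_continuous => k xi.
apply: (@continuous_comp {ptws nat -> baire} baire nat
  (proj (Cantor.of_nat k).1) (proj (Cantor.of_nat k).2)).
  exact: (@proj_continuous nat (fun _ => baire)).
exact: (@proj_continuous nat (fun _ => nat)).
Qed.

Lemma pair_dec_continuous : continuous pair_dec.
Proof.
apply: (@prod_continuous baire nat (fun _ => baire)) => n.
apply: (@prod_continuous baire nat (fun _ => nat)) => m.
exact: (@proj_continuous nat (fun _ => nat) (Cantor.to_nat (n, m))).
Qed.

Definition pair_encoding : seq_encoding :=
  SeqEncoding pair_encK pair_decK pair_enc_continuous pair_dec_continuous.

Definition j_Delta (e : seq_encoding) (p : baire) : option baire :=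
  if `[< exists n, forall m, (n <= m)%N -> dec e p m = dec e p n >]
  then Some (limn (dec e p)) else None.

Definition j_Delta_realizable (e : seq_encoding) (X Y : topologicalType)
    (rhoX : baire -> option X) (rhoY : baire -> option Y) (f : X -> Y) : Prop :=
  exists2 F : baire -> option baire, pcontinuous F &
    omap f \o rhoX =1 pcomp rhoY (pcomp (j_Delta e) F).

Definition Sigma02 (X : topologicalType) (A : set X) : Prop :=
  exists B B' : nat -> set X,
    [/\ forall i, open (B i), forall i, open (B' i) &
        A = \bigcup_i (B i `\` B' i)].

Definition Pi02 (X : topologicalType) (A : set X) : Prop := Sigma02 (~` A).

Definition Delta02 (X : topologicalType) (A : set X) : Prop :=
  Sigma02 A /\ Pi02 A.

Definition Delta02_piecewise_continuous (X Y : topologicalType)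
    (f : X -> Y) : Prop :=
  exists A : nat -> set X,
    [/\ forall i, Delta02 (A i), [set: X] = \bigcup_i A i &
        forall i, {within A i, continuous f}].

(* Main.v *)
(* From a realizer to pieces: precomposing, we may replace [rhoX] by the
   standard representation of [X], which is open.  In the fibre of the names of
   [x], the sets where the guesses [xi_n, xi_(n+1), ...] already agree cover the
   fibre as [n] varies and are closed, so by Baire category one of them contains
   the trace of a cylinder [[s]].  The points [x] for which this happens for
   given [s] and [n] form a difference of two open sets (images of open sets of
   names), on which [f] is continuous because [rhoY (xi_n)] computes it from any
   name in [[s]].

   From pieces to a realizer: refining, the domain of [rhoX] is a countable
   union of relatively closed sets [C_k], on each of which [f] has a continuous
   realizer [G_k] by admissibility of [rhoY].  The least [k] such that the name
   is in [C_k] is a limit of continuous guesses, and relatively closed subsets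
   of subspaces of Baire space are retracts, so [G_k] can be evaluated also
   when the guess [k] is wrong. *)

Require Import Defs.
From mathcomp Require Import all_boot.
From mathcomp Require Import all_classical.
From mathcomp Require Import topology.

Set Implicit Arguments.
Unset Strict Implicit.
Unset Printing Implicit Defensive.

Local Open Scope classical_set_scope.

(** * Cylinders of Baire space and continuity of partial functions *)

Definition cyl (p : baire) (n : nat) : set baire :=
  [set q | forall i, (i < n)%N -> q i = p i].

Lemma cyl_sym p q n : cyl p n q -> cyl q n p.
Proof. by move=> pq i /pq. Qed.

Lemma cyl_trans p q r n : cyl p n q -> cyl q n r -> cyl p n r.
Proof. by move=> pq qr i ltin; rewrite qr ?pq. Qed.

Lemma cyl_le p m n : (m <= n)%N -> cyl p n `<=` cyl p m.
Proof. by move=> lemn q pq i ltim; apply/pq/(leq_trans ltim). Qed.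

Lemma cyl_eq p q n : cyl p n q -> cyl q n = cyl p n.
Proof.
move=> pq; apply/seteqP; split=> r; first exact: cyl_trans pq.
exact/cyl_trans/cyl_sym.
Qed.

(** Cylinders are coded by finite sequences so that they can be enumerated. *)
Lemma cyl_mkseq p k : cyl (nth 0 (mkseq p k)) (size (mkseq p k)) = cyl p k.
Proof. by rewrite size_mkseq; apply: cyl_eq => j ltjk; rewrite nth_mkseq. Qed.

Lemma nbhs_cyl (p : baire) (U : set baire) :
  nbhs p U <-> exists n, cyl p n `<=` U.
Proof.
split; last first.
  suff nbhs_cylp n : nbhs p (cyl p n) by case=> n /filterS; apply.
  elim: n => [|n IHn]; first by apply: filterE => q i.
  have pn : nbhs p [set q : baire | q n = p n].
    exact: (@proj_continuous nat (fun _ => nat) n p _ (discrete_set1 (p n))).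
  apply: filterS2 IHn pn => q pq qn i; rewrite ltnS leq_eqVlt.
  by case/predU1P => [->//|]; exact: pq.
have F : Filter (filter_from setT (cyl p)).
  apply: filter_from_filter; first by exists 0.
  move=> m n _ _; exists (maxn m n) => // q pq.
  by split; apply: cyl_le pq; rewrite ?leq_maxl ?leq_maxr.
suff cylp : filter_from setT (cyl p) --> p.
  by move=> /cylp[n _ pU]; exists n.
apply/cvg_sup => i V [_ /= [[W oW <-] Wpi WV]].
by exists i.+1 => // q pq; apply: WV => /=; rewrite /proj pq.
Qed.

Lemma cyl_nbhs p n : nbhs p (cyl p n).
Proof. by apply/nbhs_cyl; exists n. Qed.

Lemma open_cyl p n : open (cyl p n).
Proof.
rewrite openE => q pq; apply/nbhs_cyl; exists n.
by rewrite (cyl_eq pq).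
Qed.

Lemma pcontinuousP (T : topologicalType) (F : baire -> option T) :
  pcontinuous F <-> forall p x, F p = Some x -> forall V, nbhs x V ->
    exists k, forall q y, cyl p k q -> F q = Some y -> V y.
Proof.
split=> cF.
  move=> p x Fp V; rewrite nbhsE => -[W [oW Wx] WV].
  have /open_subspaceP[U oU UF] := cF W oW.
  have /nbhs_cyl[k pU] : nbhs p U.
    apply: open_nbhs_nbhs; split=> //.
    have : (F @^-1` (Some @` W) `&` pdom F) p.
      by split; [exists x|rewrite /pdom /= Fp].
    by rewrite -UF => -[].
  exists k => q y pq Fq.
  have : (U `&` pdom F) q by split; [exact: pU|rewrite /pdom /= Fq].
  by rewrite UF => -[[z Wz]]; rewrite Fq => -[<-] _; exact: WV.
move=> V oV; apply/open_subspaceP.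
exists (\bigcup_(c in [set c : baire * nat | cyl c.1 c.2 `&` pdom F `<=`
  F @^-1` (Some @` V)]) cyl c.1 c.2).
  by apply: bigcup_open => c _; exact: open_cyl.
apply/seteqP; split=> [p [[c cV pc] Fp]|p [[x Vx Fp] Dp]].
  by split=> //; apply: cV.
split=> //; have [k pk] := cF _ _ (esym Fp) _ (open_nbhs_nbhs (conj oV Vx)).
exists (p, k) => //= q [pq]; rewrite /pdom /=.
by case Fq : (F q) => [y|//] _; exists y => //; exact: (pk q).
Qed.

Lemma pcontinuous_comp (T : topologicalType) (G : baire -> option baire)
    (F : baire -> option T) :
  pcontinuous G -> pcontinuous F -> pcontinuous (pcomp F G).
Proof.
move=> /pcontinuousP cG /pcontinuousP cF; apply/pcontinuousP => p x.
rewrite /pcomp; case Gp : (G p) => [q|//] /= Fq V Vx.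
have [m mV] := cF _ _ Fq _ Vx.
have [k km] := cG _ _ Gp _ (cyl_nbhs q m).
exists k => p' y pp'; case Gp' : (G p') => [q'|//] /=.
by apply: mV; exact: km Gp'.
Qed.

(** Admissibility of a representation of [Y], applied to this map, yields a realizer of [f] on the
    names of points of [A]. *)
Lemma pcontinuous_omap (X Y : topologicalType) (rho : baire -> option X)
    (f : X -> Y) (A : set X) :
  pcontinuous rho -> {within A, continuous f} ->
  pcontinuous (fun p => if `[< exists2 x, rho p = Some x & A x >]
                        then omap f (rho p) else None).
Proof.
move=> /pcontinuousP crho /subspace_continuousP cf; apply/pcontinuousP => p z.
case: asboolP => // -[x rp Ax]; rewrite rp /= => -[<-{z}] V Vfx.
have [k kV] := crho _ _ rp _ (cf _ Ax _ Vfx).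
exists k => q z pq; case: asboolP => // -[y rq Ay]; rewrite rq /= => -[<-].
exact: kV rq Ay.
Qed.

(** * Differences of open sets, eventually constant sequences, countable bases *)

Lemma Delta02_open_setD (X : topologicalType) (U V : set X) :
  open U -> open V -> Delta02 (U `\` V).
Proof.
move=> oU oV; split.
  exists (fun=> U), (fun=> V); split=> //.
  by apply/seteqP; split=> [x Ux|x [_ _]//]; exists 0.
(* The complement consists of the points outside [U], given by index 0, and the points of [V], given
   by all other indices. *)
exists (fun i => if i is 0 then setT else V).
exists (fun i => if i is 0 then U else set0); split.
- by case=> [|i] //; exact: openT.
- by case=> [|i] //; exact: open0.
apply/seteqP; split=> [x|x [[|i] _ [Ax nAx]]].
- case: (pselect (V x)) => Vx nUV; first by exists 1 => //; split.
  by exists 0 => //; split=> // Ux; apply: nUV.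
- by case.
- by case.
Qed.

Lemma j_DeltaP (e : seq_encoding) (w z : baire) :
  j_Delta e w = Some z <->
  exists n, forall m, (n <= m)%N -> dec e w m = z.
Proof.
have lim_dec n : (forall m, (n <= m)%N -> dec e w m = dec e w n) ->
    limn (dec e w) = dec e w n.
  move=> wn; apply: lim_near_cst; last by exists n.
  by apply: hausdorff_product => i; exact: discrete_hausdorff.
rewrite /j_Delta; split=> [|[n wn]].
  case: asboolP => // -[n wn] [<-]; exists n => m nm.
  by rewrite (lim_dec n wn) wn.
have wn' m : (n <= m)%N -> dec e w m = dec e w n.
  by move=> nm; rewrite !wn.
case: asboolP => [_|[]]; last by exists n.
by rewrite (lim_dec n wn') wn.
Qed.

Lemma second_countable_seq (X : topologicalType) : @second_countable X ->
  exists b : nat -> set X, (forall i, open (b i)) /\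
    forall x U, nbhs x U -> exists2 i, b i x & b i `<=` U.
Proof.
case=> B /pfcard_geP [B0|[b]] [oB bB].
  (* An empty base is possible only for an empty space. *)
  exists (fun=> set0); split=> [_|x U /bB[V []]]; first exact: open0.
  by rewrite B0.
exists b; split=> [i|x U /bB[V [BV Vx] VU]]; first exact/oB/funS.
by have [i _ bi] := 'surj_b BV; exists i; rewrite bi.
Qed.

(** * Enumerations of sets of numbers and the standard representation *)

Lemma extend_range (S : set nat) (p : baire) (k : nat) :
  S !=set0 -> (forall i, (i < k)%N -> S (p i)) ->
  exists2 q, cyl p k q & range q = S.
Proof.
case=> s Ss Sp.
(* After the prefix, position [i + k] carries [i] for each [i] in [S]; the remaining positions are
   filled with [s]. *)
exists (fun j => if (j < k)%N then p j
                 else if `[< S (j - k)%N >] then (j - k)%N else s).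
  by move=> i ->.
apply/seteqP; split=> [_ [j _ <-]|i Si].
  by case: ifP => [/Sp//|_]; case: asboolP.
exists (i + k)%N => //=.
by rewrite ltnNge leq_addl /= addnK; case: asboolP.
Qed.

(* Baire category for the space of enumerations of [S], i.e. for the fibres of
   the standard representation below. *)
Lemma range_baire (S : set nat) (O : nat -> set baire) :
  S !=set0 ->
  (forall n p, range p = S -> O n p ->
     exists k, forall q, range q = S -> cyl p k q -> O n q) ->
  (forall n p k, range p = S ->
     exists q, [/\ range q = S, cyl p k q & O n q]) ->
  exists2 p, range p = S & forall n, O n p.
Proof.
move=> S0 oO dO.
have [p0 _ rp0] := @extend_range S (fun=> 0) 0 S0 (fun _ => ltac:(by [])).
(* One refinement step: the new cylinder has its trace on the fibre inside [O n], and it fixes a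
   position with value [n] when [n] is in [S]. Without the latter the limit could miss elements of
   [S]. *)
pose P (x : nat * (baire * nat)) (d : baire * nat) := range x.2.1 = S ->
  [/\ range d.1 = S, cyl x.2.1 x.2.2 d.1, (x.2.2 < d.2)%N,
      forall q, range q = S -> cyl d.1 d.2 q -> O x.1 q &
      S x.1 -> exists2 j, (j < d.2)%N & d.1 j = x.1].
have /choice[next nextP] : forall x, exists d, P x d.
  case=> n [p k]; case: (pselect (range p = S)) => [rp|]; last first.
    by exists (p, k).
  have [q [rq pq Oq]] := dO n p k rp.
  have [l lO] := oO n q rq Oq.
  have [j jP] : exists j, S n -> q j = n.
    case: (pselect (S n)) => [|nSn]; last by exists 0.
    by rewrite -rq => -[j _ <-]; exists j.
  exists (q, maxn k.+1 (maxn l j.+1)); split=> //=.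
  - by rewrite leq_max leqnn.
  - move=> r rr qr; apply: lO => //; apply: cyl_le qr.
    by rewrite !leq_max leqnn orbT.
  - by move=> /jP <-; exists j; rewrite // !leq_max leqnn !orbT.
pose s := fix s n := if n is m.+1 then next (m, s m) else (p0, 0).
have rs n : range (s n).1 = S.
  by elim: n => // n IHn; case: (nextP (n, s n) IHn).
have sP n := nextP (n, s n) (rs n).
have s_cyl m d : cyl (s m).1 (s m).2 (s (d + m)%N).1 /\
    ((s m).2 <= (s (d + m)%N).2)%N.
  elim: d => [//|d [IHc IHl]]; have [_ /= c l _ _] := sP (d + m)%N.
  split; last exact: leq_trans (ltnW l).
  by apply: cyl_trans IHc _; exact: cyl_le c.
have le_s n : (n <= (s n).2)%N.
  by elim: n => // n IHn; have [_ _ /= l _ _] := sP n; exact: leq_ltn_trans l.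
(* The cylinder of stage [i.+1] has length at least [i.+1], so coordinate [i] is settled there. *)
pose p : baire := fun i => (s i.+1).1 i.
have ps n : cyl (s n).1 (s n).2 p.
  move=> i ltin; rewrite /p; case: (leqP n i.+1) => [lni|ltn].
    by rewrite -(subnK lni); case: (s_cyl n (i.+1 - n)%N) => + _; apply.
  rewrite -(subnK (ltnW ltn)); case: (s_cyl i.+1 (n - i.+1)%N) => + _.
  by move=> ->//; exact: le_s.
have rp : range p = S.
  apply/seteqP; split=> [_ [i _ <-]|i Si]; first by rewrite -(rs i.+1); exists i.
  have [_ _ _ _ /(_ Si)[j ltj /= sj]] := sP i.
  by exists j => //; rewrite (ps i.+1).
exists p => // n; have [_ _ _ + _] := sP n; apply=> //; exact: (ps n.+1).
Qed.

(* The standard representation of a countably based T0 space: a name of [x]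
   enumerates the indices of the basic neighbourhoods of [x].  Unlike an
   arbitrary admissible representation it is an open map. *)
Definition names (X : Type) (b : nat -> set X) (p : baire) (x : X) : Prop :=
  range p = [set i | b i x].

Definition std_rep (X : Type) (b : nat -> set X) (p : baire) : option X :=
  if pselect (exists x, names b p x) is left px then Some (projT1 (cid px))
  else None.

(** A name determines the basic neighbourhoods of its point, hence by T0 the point itself. *)
Lemma std_repP (X : topologicalType) (b : nat -> set X) p x :
  kolmogorov_space X ->
  (forall x U, nbhs x U -> exists2 i, b i x & b i `<=` U) ->
  std_rep b p = Some x <-> names b p x.
Proof.
move=> T0 bP; rewrite /std_rep; split.
  by case: pselect => // px [<-]; case: cid.
move=> px; case: pselect => [px'|[]]; last by exists x.
case: cid => y /= py; congr Some; apply/eqP/negP => /negP/T0[A].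
have sub u v : names b p u -> names b p v -> A \in nbhs u -> v \in ~` A -> False.
  move=> pu pv; rewrite !inE => /bP[i biu bA]; apply; apply: bA.
  by suff : [set j | b j v] i by []; rewrite -pv pu.
by case=> -[]; apply: sub.
Qed.

Lemma std_rep_continuous (X : topologicalType) (b : nat -> set X) :
  kolmogorov_space X ->
  (forall x U, nbhs x U -> exists2 i, b i x & b i `<=` U) ->
  pcontinuous (std_rep b).
Proof.
move=> T0 bP; apply/pcontinuousP => p x /std_repP-/(_ T0 bP) px V.
move=> /bP[i bix biV].
have : range p i by rewrite px.
case=> j _ pj; exists j.+1 => q y pq /std_repP-/(_ T0 bP) qy; apply: biV.
by suff : [set i | b i y] i by []; rewrite -qy; exists j => //; rewrite pq.
Qed.

(** A prefix of a name of [x] lists finitely many basic sets, and every point of their intersection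
    has a name extending that prefix. *)
Lemma std_rep_open (X : topologicalType) (b : nat -> set X) (W : set baire) :
  (forall i, open (b i)) ->
  (forall x U, nbhs x U -> exists2 i, b i x & b i `<=` U) ->
  (forall p x, W p -> names b p x -> exists k, forall q y,
     cyl p k q -> names b q y -> W q) ->
  open [set x | exists2 p, W p & names b p x].
Proof.
move=> ob bP oW; rewrite openE => x [p Wp px].
have [k kW] := oW p x Wp px.
have : nbhs x [set y | forall i, (i < k)%N -> b (p i) y].
  elim: k {kW} => [|k IHk]; first by apply: filterE => y i.
  have bk : nbhs x (b (p k)).
    apply: open_nbhs_nbhs; split=> //.
    by suff : [set i | b i x] (p k) by []; rewrite -px; exists k.
  apply: filterS2 IHk bk => y yk yk' i; rewrite ltnS leq_eqVlt.
  by case/predU1P => [->//|]; exact: yk.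
apply: filterS => y yk.
have [i biy _] := bP y setT filterT.
have [|q pq qy] := @extend_range [set i | b i y] p k _ yk; first by exists i.
by exists q => //; exact: kW qy.
Qed.

(** * From a realizer to pieces *)

Lemma pcontinuous_dec (e : seq_encoding) (m : nat) :
  pcontinuous (fun w => Some (dec e w m)).
Proof.
apply/pcontinuousP => w x [<-] V Vw.
have /nbhs_cyl[k kV] : nbhs w [set w' | V (dec e w' m)].
  have := @dec_continuous e w [set xi | V (xi m)]; apply.
  exact: (@proj_continuous nat (fun _ => baire) m (dec e w) _ Vw).
by exists k => q y wq [<-]; exact: kV.
Qed.

Lemma pieces_of_j_Delta_realizable (e : seq_encoding) (X Y : topologicalType)
    (rhoX : baire -> option X) (rhoY : baire -> option Y) (f : X -> Y) :
  kolmogorov_space X -> @second_countable X -> admissible rhoX ->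
  pcontinuous rhoY -> j_Delta_realizable e rhoX rhoY f ->
  Delta02_piecewise_continuous f.
Proof.
move=> T0 /second_countable_seq[b [ob bP]] [_ _ uX] crY [F cF fF].
have repP p x := @std_repP X b p x T0 bP.
(* [G] translates standard names into [rhoX]-names; [h n] is then the guess number [n] computed from
   a standard name. *)
have [G cG deltaG] := uX _ (std_rep_continuous T0 bP).
pose h n := pcomp (fun w => Some (dec e w n)) (pcomp F G).
have ch n : pcontinuous (h n).
  apply: pcontinuous_comp; last exact: pcontinuous_dec.
  exact: pcontinuous_comp.
pose stab n : set baire := [set p | forall m, (n <= m)%N -> h m p = h n p].
have h_def p x n : names b p x -> exists z, h n p = Some z.
  move=> /repP px; move: (px); rewrite deltaG /h /pcomp.
  case: (G p) => [q|//] /= qx; have := fF q; rewrite /= qx /= /pcomp.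
  by case: (F q) => [w|//] /= _; exists (dec e w n).
have lim_h p x : names b p x -> exists n z, rhoY z = Some (f x) /\
    forall m, (n <= m)%N -> h m p = Some z.
  move=> /repP px; move: (px); rewrite deltaG /h /pcomp.
  case: (G p) => [q|//] /= qx; have := fF q; rewrite /= qx /= /pcomp.
  case: (F q) => [w|//] /=; case jw: (j_Delta e w) => [z|//] /= /esym rz.
  have /j_DeltaP[n wn] := jw; exists n, z; split=> // m nm; by rewrite wn.
have stabP n p x : names b p x -> stab n p -> pcomp rhoY (h n) p = Some (f x).
  move=> /lim_h[m [z [rz hz]]] st; rewrite {1}/pcomp.
  by rewrite -(st (maxn n m)) ?leq_maxl // hz ?leq_maxr.
(* Among names, [stab n] is closed: two different guesses differ at some coordinate, and continuity
   preserves this on a cylinder. *)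
have nstab n p x : names b p x -> ~ stab n p ->
    exists k, forall q y, cyl p k q -> names b q y -> ~ stab n q.
  move=> px nst.
  have [m [nm hm]] : exists m, (n <= m)%N /\ h m p <> h n p.
    apply: contra_notP nst => H m nm; apply: contra_notP H => hm.
    by exists m.
  have [u hu] := h_def _ _ m px; have [v hv] := h_def _ _ n px.
  have [i uvi] : exists i, u i <> v i.
    apply: contra_notP hm => H; rewrite hu hv; congr Some; apply/funext => i.
    by apply: contra_notP H => uvi; exists i.
  have /pcontinuousP/(_ _ _ hu _ (cyl_nbhs u i.+1))[k ku] := ch m.
  have /pcontinuousP/(_ _ _ hv _ (cyl_nbhs v i.+1))[l lv] := ch n.
  exists (maxn k l) => q y pq qy st.
  have [u' hu'] := h_def _ _ m qy; have [v' hv'] := h_def _ _ n qy.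
  have uu' := ku _ _ (cyl_le (leq_maxl k l) pq) hu'.
  have vv' := lv _ _ (cyl_le (leq_maxr k l) pq) hv'.
  apply: uvi; rewrite -(uu' i) // -(vv' i) //.
  by have := st m nm; rewrite hu' hv' => -[->].
(* A point is in [U s] but not in [V s n] when it has names in the cylinder of [s] and all of these
   are stable from [n] on. *)
pose U (s : seq nat) := [set x | exists2 p, cyl (nth 0 s) (size s) p &
  names b p x].
pose V s n := [set x | exists2 p, cyl (nth 0 s) (size s) p /\ ~ stab n p &
  names b p x].
have oU s : open (U s).
  apply: std_rep_open => // p x sp px; exists (size s) => q y pq _.
  exact: cyl_trans pq.
have oV s n : open (V s n).
  apply: std_rep_open => // p x [sp st] px; have [k kst] := nstab _ _ _ px st.
  exists (maxn (size s) k) => q y pq qy; split.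
    by apply: (cyl_trans sp); apply: cyl_le pq; exact: leq_maxl.
  by apply: kst qy; apply: cyl_le pq; exact: leq_maxr.
(* Indices that code no pair only repeat the piece of [([::], 0)]. *)
pose c i : seq nat * nat := odflt ([::], 0) (unpickle i).
exists (fun i => U (c i).1 `\` V (c i).1 (c i).2); split.
- by move=> i; exact: Delta02_open_setD.
- apply/esym; rewrite -subTset => x _; apply: contrapT => nA.
  (* If [x] were in no piece, the names unstable at [n] would be dense in the fibre for every [n],
     and Baire category would give a name of [x] whose guesses never settle. *)
  have xV s n : U s x -> V s n x.
    move=> Ux; apply: contrapT => nV; apply: nA.
    by exists (pickle (s, n)) => //; rewrite /c pickleK.
  have [i bi _] := bP x setT filterT.
  have [||| p px nst] :=
      @range_baire [set i | b i x] (fun n => ~` stab n).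
  + by exists i.
  + move=> n p px /(nstab _ _ _ px)[k kst]; exists k => q qx pq.
    exact: kst pq qx.
  + move=> n p k px.
    have [|q [pq st] qx] := xV (mkseq p k) n.
      by exists p => //; rewrite cyl_mkseq.
    by exists q; split=> //; rewrite -cyl_mkseq.
  have [n [z [_ hz]]] := lim_h _ _ px.
  by apply: (nst n) => m nm; rewrite !hz.
- move=> i; move: (c i) => [s n] /=; apply/subspace_continuousP.
  move=> x [[p sp px] nV] W Wfx.
  have st q y : cyl (nth 0 s) (size s) q -> names b q y -> ~ V s n y ->
      stab n q.
    by move=> sq qy nVy; apply: contrapT => st; apply: nVy; exists q.
  have [k kW] := (pcontinuousP _).1 (pcontinuous_comp (ch n) crY) _ _
    (stabP _ _ _ px (st _ _ sp px nV)) _ Wfx.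
  (* This image of a cylinder is a neighbourhood of [x]. Its points in the piece have names there
     that are stable from [n] on, so [h n] computes their values. *)
  have oT : open [set y | exists2 q, cyl p (maxn (size s) k) q & names b q y].
    apply: std_rep_open => // q y pq _; exists (maxn (size s) k) => r z.
    by move=> qr _; exact: cyl_trans qr.
  have xT : nbhs x [set y | exists2 q, cyl p (maxn (size s) k) q & names b q y].
    by apply: open_nbhs_nbhs; split=> //; exists p.
  rewrite /= nbhs_simpl /within /=; apply: filterS xT => y [q pq qy] [_ nVy].
  apply: (kW q).
    by apply: cyl_le pq; exact: leq_maxr.
  apply: stabP => //; apply: st nVy => //.
  by apply: (cyl_trans sp); apply: cyl_le pq; exact: leq_maxl.
Qed.

(** * From pieces to a realizer *)

Lemma cyl_retract (D C : set baire) :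
  C !=set0 ->
  (forall p, D p -> ~ C p -> exists n, cyl p n `<=` ~` C) ->
  exists r : baire -> baire,
    [/\ forall p, D p -> C (r p), forall p, C p -> r p = p &
        {within D, continuous r}].
Proof.
move=> [c Cc] clC.
(* These points of [C] agree with [p] for as long as any point of [C] does. *)
pose close p := [set q | C q /\
  forall m, cyl p m `&` C !=set0 -> cyl p m q].
have closeC p q : C p -> close p q -> q = p.
  move=> Cp [_ pq]; apply/funext => i.
  by apply: (pq i.+1) => //; exists p.
(* The choice depends only on the set [close p]. Near a point of [D] outside [C] this set does not
   vary, so [r] is locally constant there. *)
pose r p := xget (fun=> 0) (close p).
have rP p : D p -> close p (r p).
  move=> Dp; apply: xgetPex; case: (pselect (C p)) => [Cp|nCp].
    by exists p.
  have [n pn] := clC p Dp nCp.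
  have ex : exists m, `[< cyl p m `&` C !=set0 >].
    by exists 0; apply/asboolP; exists c.
  have ub m : `[< cyl p m `&` C !=set0 >] -> (m <= n)%N.
    move=> /asboolP[q [pq Cq]]; rewrite leqNgt; apply/negP => ltnm.
    by apply: pn Cq; apply: cyl_le pq; exact: ltnW.
  case: (ex_maxnP ex ub) => m /asboolP[q [pq Cq]] mmax.
  exists q; split=> // l pl; apply: cyl_le pq; apply: mmax; exact/asboolP.
have rC p : C p -> r p = p.
  move=> Cp; apply: (closeC _ _ Cp); apply: xgetPex.
  by exists p.
exists r; split=> // [p /rP[]//|].
apply/subspace_continuousP => p Dp V /nbhs_cyl[m mV].
case: (pselect (C p)) => [Cp|nCp].
  (* Here [q] shares a prefix of length [m] with the point [p] of [C], so [r q] shares it too. *)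
  rewrite /= nbhs_simpl /within /=; apply: filterS (cyl_nbhs p m) => q pq Dq.
  apply: mV; rewrite /from_subspace rC //; have [_ rq] := rP q Dq.
  by rewrite -(cyl_eq pq); apply: rq; exists p; split=> //; exact: cyl_sym.
have [n pn] := clC p Dp nCp.
rewrite /= nbhs_simpl /within /=; apply: filterS (cyl_nbhs p n) => q pq Dq.
apply: mV; rewrite /from_subspace; suff -> : r q = r p by [].
have meet l u v : cyl u n `<=` ~` C -> cyl u n v ->
    cyl u l `&` C !=set0 -> cyl u l = cyl v l.
  move=> un uv [w [ul Cw]]; apply/esym/cyl_eq; apply: cyl_le uv.
  by rewrite leqNgt; apply/negP => ltnl; apply: un Cw; apply: cyl_le ul; apply: ltnW.
rewrite /r; congr xget; apply/seteqP; split=> u [Cu uP]; split=> // l lC.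
  by rewrite (meet l p q) //; apply: uP; rewrite -(meet l p q).
have qn : cyl q n `<=` ~` C by rewrite (cyl_eq pq).
have qp := cyl_sym pq.
by rewrite (meet l q p) //; apply: uP; rewrite -(meet l q p).
Qed.

(* The [n]-th guess for [p] is the least [k] such that some point of [C k]
   agrees with [p] up to [n]; composing [G k] with a retraction onto [C k]
   makes its value meaningful even when the guess is wrong. *)
Lemma closed_pieces_limit (D : set baire) (C : nat -> set baire)
    (G : nat -> baire -> option baire) :
  (forall p, D p -> exists k, C k p) ->
  (forall k p, D p -> ~ C k p -> exists n, cyl p n `<=` ~` C k) ->
  (forall k, pcontinuous (G k)) -> (forall k p, C k p -> G k p) ->
  exists xi : nat -> baire -> baire,
    (forall n, {within D, continuous (xi n)}) /\
    forall p, D p -> exists k N, C k p /\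
      forall n, (N <= n)%N -> G k p = Some (xi n p).
Proof.
move=> covC clC cG domG.
have /choice[r rP] : forall k, exists r : baire -> baire, C k !=set0 ->
    [/\ forall p, D p -> C k (r p), forall p, C k p -> r p = p &
        {within D, continuous r}].
  (* An empty [C k] is never guessed on [D], so any function will do. *)
  move=> k; case: (pselect (C k !=set0)) => [Ck|nCk]; last by exists id.
  by have [r rP] := cyl_retract Ck (clC k); exists r.
pose guess n p := [set k | cyl p n `&` C k !=set0 /\
  forall j, (j < k)%N -> ~ (cyl p n `&` C j !=set0)].
pose K n p := xget 0 (guess n p).
have KP n p : D p -> guess n p (K n p).
  move=> Dp; apply: xgetPex.
  have ex : exists k, `[< cyl p n `&` C k !=set0 >].
    by have [k Ckp] := covC p Dp; exists k; apply/asboolP; exists p.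
  case: (ex_minnP ex) => k /asboolP pk kmin; exists k; split=> // j ltjk pj.
  by have := kmin j; rewrite leqNgt ltjk => /(_ (introT (asboolP _) pj)).
have K_uniq n p k : guess n p k -> K n p = k.
  move=> gk; have [] : guess n p (K n p) by apply: xgetPex; exists k.
  case: gk => pk kmin pK Kmin.
  by case: (ltngtP (K n p) k) => // [/kmin|/Kmin].
have rK n p : D p -> C (K n p) (r (K n p) p).
  move=> Dp; have [[q [_ Cq]] _] := KP n p Dp.
  by have [|rD _ _] := rP (K n p); [exists q|exact: rD].
pose xi n p := odflt (fun=> 0) (G (K n p) (r (K n p) p)).
have xiE n p : D p -> G (K n p) (r (K n p) p) = Some (xi n p).
  by move=> /(rK n)/domG; rewrite /xi; case: (G _ _).
exists xi; split=> [n|p Dp].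
  apply/subspace_continuousP => p Dp V Vxi.
  have [pC _] := KP n p Dp.
  have [|_ _ /subspace_continuousP cr] := rP (K n p).
    by case: pC => q [_ Cq]; exists q.
  have [m mV] := (pcontinuousP _).1 (cG (K n p)) _ _ (xiE n p Dp) _ Vxi.
  have := cr p Dp _ (cyl_nbhs (r (K n p) p) m).
  rewrite /= !nbhs_simpl /within /= => rpm.
  apply: filterS2 rpm (cyl_nbhs p n) => q /= rq pq Dq.
  (* The guess depends only on the cylinder of length [n], hence is locally constant. *)
  have Kq : K n q = K n p by rewrite /K /guess (cyl_eq pq).
  by apply: (mV _ _ (rq Dq)); rewrite -Kq xiE.
have ex : exists k, `[< C k p >].
  by have [k Ckp] := covC p Dp; exists k; apply/asboolP.
case: (ex_minnP ex) => k /asboolP Ckp kmin; exists k.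
(* Each earlier [C j] misses a cylinder around [p]; one length serves for all [j < k], and from then
   on the guess is [k]. *)
have [N NP] : exists N, forall j, (j < k)%N -> cyl p N `<=` ~` C j.
  have : forall j, (j < k)%N -> ~ C j p.
    by move=> j ltjk /asboolP/kmin; rewrite leqNgt ltjk.
  elim: (k) => [|l IHl] nC; first by exists 0.
  have [j jl|N NP] := IHl; first by apply: nC; exact: ltnW.
  have [n np] := clC l p Dp (nC l (leqnn _)).
  exists (maxn N n) => j; rewrite ltnS leq_eqVlt => /predU1P[->|jl] q pq.
    by apply: np; apply: cyl_le pq; exact: leq_maxr.
  by apply: (NP j jl); apply: cyl_le pq; exact: leq_maxl.
exists N; split=> // n Nn.
have Kk : K n p = k.
  apply: K_uniq; split=> [|j jk [q [pq Cq]]]; first by exists p.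
  by apply: (NP j jk q) Cq; exact: cyl_le pq.
have [|_ rk _] := rP k; first by exists p.
by rewrite -(xiE n p Dp) Kk rk.
Qed.

Lemma pcontinuous_enc (e : seq_encoding) (D : set baire)
    (xi : nat -> baire -> baire) :
  (forall n, {within D, continuous (xi n)}) ->
  pcontinuous (fun p => if `[< D p >] then Some (enc e (xi^~ p)) else None).
Proof.
move=> cxi; apply/pcontinuousP => p x; case: asboolP => // Dp [<-{x}] V Vp.
have cD : continuous (fun p : subspace D => xi^~ p : {ptws nat -> baire}).
  exact: (@prod_continuous (subspace D) nat (fun=> baire)).
have := (subspace_continuousP _ _).1 cD p Dp [set eta | V (enc e eta)].
move=> /(_ (@enc_continuous e (xi^~ p) V Vp)).
rewrite /= nbhs_simpl /within /= => /nbhs_cyl[k kV].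
by exists k => q y pq; case: asboolP => // Dq [<-]; exact: kV.
Qed.

Lemma j_Delta_realizable_of_pieces (e : seq_encoding) (X Y : topologicalType)
    (rhoX : baire -> option X) (rhoY : baire -> option Y) (f : X -> Y) :
  pcontinuous rhoX -> admissible rhoY ->
  Delta02_piecewise_continuous f -> j_Delta_realizable e rhoX rhoY f.
Proof.
move=> crX [_ _ uY] [A [dA covA cA]].
have /choice[B] : forall i, exists B : (nat -> set X) * (nat -> set X),
    [/\ forall j, open (B.1 j), forall j, open (B.2 j) &
        A i = \bigcup_j (B.1 j `\` B.2 j)].
  by move=> i; have [[U [U' UP]] _] := dA i; exists (U, U').
move=> BP; pose D := pdom rhoX.
have DP p : D p <-> exists x, rhoX p = Some x.
  by rewrite /D /pdom /=; case: (rhoX p) => [x|]; split=> //; [exists x|case].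
(* [B_j \ B'_j] pulls back to a relatively closed set on each cylinder that
   is mapped into [B_j]. *)
pose piece (c : nat * nat * seq nat) : set baire := let: (i, j, s) := c in
  [set p | [/\ cyl (nth 0 s) (size s) p,
    forall q x, cyl (nth 0 s) (size s) q -> rhoX q = Some x -> (B i).1 j x &
    exists2 x, rhoX p = Some x & ~ (B i).2 j x]].
pose c k : nat * nat * seq nat := odflt (0, 0, [::]) (unpickle k).
have /choice[G GP] : forall k, exists G, pcontinuous G /\
    forall p x, piece (c k) p -> rhoX p = Some x ->
      pcomp rhoY G p = Some (f x).
  move=> k; case: (c k) => -[i j] s.
  have [G cG GE] := uY _ (pcontinuous_omap crX (cA i)).
  exists G; split=> // p x [sp sB [y py nB']]; rewrite -GE py => -[<-].
  case: asboolP => //= -[]; exists y => //.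
  by have [_ _ ->] := BP i; exists j => //; split=> //; exact: sB sp py.
have [||||xi [cxi xiP]] := @closed_pieces_limit D (fun k => piece (c k)) G.
- move=> p /DP[x px].
  have : [set: X] x by []; rewrite covA => -[i _].
  have [oB _ ->] := BP i => -[j _ [Bx nBx]].
  have [k kB] := (pcontinuousP _).1 crX _ _ px _
    (open_nbhs_nbhs (conj (oB j) Bx)).
  exists (pickle (i, j, mkseq p k)); rewrite /c pickleK /= /piece cyl_mkseq.
  by split=> //; exists x.
- move=> k p /DP[x px]; case: (c k) => -[i j] s /= np.
  have [_ oB' _] := BP i.
  case: (pselect (cyl (nth 0 s) (size s) p)) => sp; last first.
    by exists (size s) => q pq [sq _ _]; apply/sp/(cyl_trans sq)/cyl_sym.
  case: (pselect ((B i).2 j x)) => B'x.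
    have [l lB] := (pcontinuousP _).1 crX _ _ px _
      (open_nbhs_nbhs (conj (oB' j) B'x)).
    by exists l => q pq [_ _ [y qy]]; apply; exact: lB qy.
  (* The piece is empty: a point of it would show that the cylinder of [s] is mapped into
     [(B i).1 j], which would put [p] in the piece. *)
  exists 0 => q _ [_ sB _]; apply: np; split=> //.
  by exists x.
- by move=> k; have [] := GP k.
- move=> k p Cp; have [_ /(_ p)] := GP k.
  have [x px] : exists x, rhoX p = Some x.
    by move: Cp; case: (c k) => -[i j] s [_ _ [x px _]]; exists x.
  by move=> /(_ x Cp px); rewrite /pcomp; case: (G k p).
(* The guesses are restricted to the domain of [rhoX] because the two composites must also have
   equal domains. *)
exists (fun p => if `[< D p >] then Some (enc e (xi^~ p)) else None).
  exact: pcontinuous_enc.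
move=> p; rewrite /= /pcomp; case: asboolP => [Dp|nDp]; last first.
  by move: nDp; rewrite /D /pdom /=; case: (rhoX p).
have [x px] := (DP p).1 Dp; have [k [N [Cp GN]]] := xiP p Dp.
have := (GP k).2 p x Cp px; rewrite px /pcomp /= (GN N (leqnn N)) /= => rz.
suff -> : j_Delta e (enc e (xi^~ p)) = Some (xi N p) by [].
apply/j_DeltaP; exists N => m Nm; rewrite encK.
by have := GN m Nm; rewrite (GN N (leqnn N)) => -[].
Qed.

Theorem theorem17 (e : seq_encoding) (X Y : topologicalType)
    (rhoX : baire -> option X) (rhoY : baire -> option Y) (f : X -> Y)
    (X_T0 : kolmogorov_space X) (X_sc : @second_countable X)
    (Y_T0 : kolmogorov_space Y) (Y_sc : @second_countable Y)
    (rhoX_adm : admissible rhoX) (rhoY_adm : admissible rhoY) :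
  j_Delta_realizable e rhoX rhoY f <-> Delta02_piecewise_continuous f.
Proof.
have [_ crX _] := rhoX_adm; have [_ crY _] := rhoY_adm.
split; first exact: pieces_of_j_Delta_realizable.
exact: j_Delta_realizable_of_pieces.
Qed.
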